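(* Let $(A,\cdot,\{\,,\,,\,\})$ be a Nambu-Poisson algebra and let $(A,\cdot_t,\{\,,\,,\,\}_t)$ be a trivial $(1,2)$-linear deformation of it. Let $N:A\to A$ be a linear map such that $\mathrm{Id}+tN:A\to A$ defines an equivalence of the deformation $(A,\cdot_t,\{\,,\,,\,\}_t)$ with the undeformed one $(A,\cdot,\{\,,\,,\,\})$. Then $N$ is a Nijenhuis operator on the Nambu-Poisson algebra $(A,\cdot,\{\,,\,,\,\})$.
   Context: All vector spaces and (multi)linear maps are over a field $k$ of characteristic $0$. A 3-Lie algebra is a vector space $\mathcal L$ with a skew-symmetric trilinear operation $\{\,,\,,\,\}$ satisfying $\{a,b,\{c,d,e\}\}=\{\{a,b,c\},d,e\}+\{c,\{a,b,d\},e\}+\{c,d,\{a,b,e\}\}$. A Nambu-Poisson algebra $(A,\cdot,\{\,,\,,\,\})$ is a commutative associative algebra $(A,\cdot)$ (not assumed unital) together with a 3-Lie algebra structure $\{\,,\,,\,\}$ on $A$ such that $\{a,b,c\cdot d\}=\{a,b,c\}\cdot d+c\cdot\{a,b,d\}$ for all $a,b,c,d\in A$. A homomorphism of Nambu-Poisson algebras is a linear map preserving both operations. A $(1,2)$-linear deformation of $A$ consists of parametrized operations $a\cdot_t b=a\cdot b+t\,\varphi_1(a,b)$ and $\{a,b,c\}_t=\{a,b,c\}+t\,\psi_1(a,b,c)+t^2\,\psi_2(a,b,c)$, with $\varphi_1:A\times A\to A$ symmetric bilinear and $\psi_1,\psi_2:A\times A\times A\to A$ skew-symmetric trilinear, such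 that $(A,\cdot_t,\{\,,\,,\,\}_t)$ is a Nambu-Poisson algebra; here $t$ is a parameter and identities are required identically in $t$ (coefficients of each power of $t$ are compared). Two $(1,2)$-linear deformations $(A,\cdot_t,\{\,,\,,\,\}_t)$ and $(A,\cdot'_t,\{\,,\,,\,\}'_t)$ are equivalent if there is a linear map $N:A\to A$ such that $\mathrm{Id}+tN$ is a homomorphism of Nambu-Poisson algebras from $(A,\cdot_t,\{\,,\,,\,\}_t)$ to $(A,\cdot'_t,\{\,,\,,\,\}'_t)$ (identically in $t$). A deformation is trivial if it is equivalent to the undeformed one (i.e. $\cdot'_t=\cdot$ and $\{\,,\,,\,\}'_t=\{\,,\,,\,\}$). A linear map $N:A\to A$ is a Nijenhuis operator on $A$ if for all $a,b,c\in A$: $N(a)\cdot N(b)=N\big(N(a)\cdot b+a\cdot N(b)-N(a\cdot b)\big)$ and $\{N(a),N(b),N(c)\}=N\Big(\{N(a),N(b),c\}+\{N(a),b,N(c)\}+\{a,N(b),N(c)\}-N\big(\{N(a),b,c\}+\{a,N(b),c\}+\{a,b,N(c)\}-N\{a,b,c\}\big)\Big)$. *)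

(* Defs.v *)
From HB Require Import structures.
From mathcomp Require Import all_boot all_order all_algebra finmap.
From mathcomp Require Import sesquilinear.
From mathcomp.multinomials Require Import monalg.

Set Implicit Arguments.
Unset Strict Implicit.
Unset Printing Implicit Defensive.

Import GRing.Theory.
Local Open Scope fset_scope.
Local Open Scope ring_scope.

(* Nambu-Poisson algebras over a commutative ring R. They are used both for
   R = k, on the vector space A, and for R = k[t], on the module A[t]. *)
Section NambuPoisson.
Variables (R : comNzRingType) (M : lmodType R).
Implicit Types (mul : M -> M -> M) (br : M -> M -> M -> M).

Definition sym_bilinear mul : Prop :=
  bilinear_for *:%R *:%R mul /\ commutative mul.

Definition skew_trilinear br : Prop :=
  [/\ forall b c, linear (fun a => br a b c),
      forall a c, linear (fun b => br a b c),
      forall a b, linear (fun c => br a b c),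
      forall a b c, br b a c = - br a b c
    & forall a b c, br a c b = - br a b c].

Definition fundamental_identity br : Prop := forall a b c d e,
  br a b (br c d e) = br (br a b c) d e + br c (br a b d) e + br c d (br a b e).

Definition leibniz_rule mul br : Prop := forall a b c d,
  br a b (mul c d) = mul (br a b c) d + mul c (br a b d).

Definition nambu_poisson mul br : Prop :=
  [/\ sym_bilinear mul, associative mul,
      skew_trilinear br, fundamental_identity br & leibniz_rule mul br].

Definition nambu_poisson_hom mul br mul' br' (f : M -> M) : Prop :=
  [/\ linear f, forall a b, f (mul a b) = mul' (f a) (f b)
    & forall a b c, f (br a b c) = br' (f a) (f b) (f c)].

Definition nijenhuis mul br (N : M -> M) : Prop :=
  [/\ linear N,
      forall a b,
        mul (N a) (N b) = N (mul (N a) b + mul a (N b) - N (mul a b))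
    & forall a b c,
        br (N a) (N b) (N c) =
        N (br (N a) (N b) c + br (N a) b (N c) + br a (N b) (N c)
           - N (br (N a) b c + br a (N b) c + br a b (N c) - N (br a b c)))].

End NambuPoisson.

(* A[t]: finitely supported families of coefficients, << a *g i >> standing
   for a t^i and f@_i for the coefficient of t^i in f. *)
Definition tpoly (k : fieldType) (A : lmodType k) : Type := {malg A[nat]}.

HB.instance Definition _ (k : fieldType) (A : lmodType k) :=
  GRing.Zmodule.on (tpoly A).

Section MonomialSum.
Variables (A B : zmodType) (F : nat -> A -> B).
Hypothesis FD : forall i, {morph F i : x y / x + y}.

Definition tsum (f : {malg A[nat]}) : B := \sum_(i <- msupp f) F i f@_i.

Lemma tsum_F0 i : F i 0 = 0.
Proof. by apply: (addrI (F i 0)); rewrite -FD !addr0. Qed.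

Lemma tsumEw (d : {fset nat}) f : msupp f `<=` d ->
  tsum f = \sum_(i <- d) F i f@_i.
Proof.
move=> le_fd; apply: big_fset_incl => // i _ /mcoeff_outdom ->.
exact: tsum_F0.
Qed.

Lemma tsumD : {morph tsum : f g / f + g}.
Proof.
move=> f g; rewrite (tsumEw (msuppD_le f g)).
rewrite (tsumEw (fsubsetUl (msupp f) (msupp g))).
rewrite (tsumEw (fsubsetUr (msupp f) (msupp g))) -big_split /=.
by apply: eq_bigr => i _; rewrite mcoeffD FD.
Qed.

Lemma tsum0 : tsum 0 = 0.
Proof. by rewrite /tsum msupp0 big_seq_fset0. Qed.

Lemma tsumU a i : tsum << a *g i >> = F i a.
Proof. by rewrite (tsumEw msuppU_le) big_seq_fset1 mcoeffUU. Qed.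

End MonomialSum.

Section Polynomials.
Variables (k : fieldType) (A : lmodType k).
Local Notation At := (tpoly A).
Implicit Types (p q : {poly k}) (f g h : At).

Definition tmono (a : A) (i : nat) : At := << a *g i >>.

Definition tscale p f : At :=
  \sum_(i < size p) tsum (fun j a => tmono (p`_i *: a) (i + j)) f.

Lemma tmonoD i : {morph tmono^~ i : a b / a + b}.
Proof. exact: monalgUD. Qed.

Lemma tmono0 i : tmono 0 i = 0.
Proof. exact: monalgU0. Qed.

Lemma tpoly_ind (P : At -> Prop) :
  P 0 -> (forall f g, P f -> P g -> P (f + g)) ->
  (forall a i, P (tmono a i)) -> forall f, P f.
Proof.
move=> P0 PD PU f; rewrite (monalgE f); apply: (big_ind P) => // i _.
exact: PU.
Qed.

Let tscaleF c i j : {morph (fun a => tmono (c *: a) (i + j)) : a b / a + b}.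
Proof. by move=> a b; rewrite scalerDr tmonoD. Qed.

Lemma tscaleEw n p f : (size p <= n)%N ->
  tscale p f = \sum_(i < n) tsum (fun j a => tmono (p`_i *: a) (i + j)) f.
Proof.
move=> le_pn; rewrite /tscale.
rewrite (big_ord_widen n (fun i => tsum (fun j a => tmono (p`_i *: a) (i + j)) f) le_pn).
rewrite big_mkcond; apply: eq_bigr => i _.
case: ltnP => // le_pi; rewrite nth_default // /tsum big1 // => j _.
by rewrite scale0r tmono0.
Qed.

Lemma tscaleDr p : {morph tscale p : f g / f + g}.
Proof.
move=> f g; rewrite /tscale -big_split; apply: eq_bigr => i _ /=.
by rewrite tsumD // => j; apply: tscaleF.
Qed.

Lemma tscale0r p : tscale p 0 = 0.
Proof. by rewrite /tscale big1 // => i _; rewrite tsum0. Qed.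

Lemma tscaleDl f : {morph tscale^~ f : p q / p + q}.
Proof.
move=> p q; set n := maxn (size p) (size q).
rewrite (@tscaleEw n (p + q)) ?size_polyD //.
rewrite (@tscaleEw n p) ?leq_maxl // (@tscaleEw n q) ?leq_maxr //.
rewrite -big_split; apply: eq_bigr => i _ /=.
rewrite /tsum -big_split; apply: eq_bigr => j _ /=.
by rewrite coefD scalerDl tmonoD.
Qed.

Lemma tscale0l f : tscale 0 f = 0.
Proof. by rewrite /tscale size_poly0 big_ord0. Qed.

Lemma tscaleUU c i a j : tscale (c *: 'X^i) (tmono a j) = tmono (c *: a) (i + j).
Proof.
rewrite (@tscaleEw i.+1); last first.
  by rewrite (leq_trans (size_scale_leq _ _)) ?size_polyXn.
rewrite big_ord_recr /= big1 => [|l _]; rewrite tsumU; try exact: tscaleF.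
  by rewrite coefZ coefXn eqxx mulr1 add0r.
by rewrite coefZ coefXn ltn_eqF // mulr0 scale0r tmono0.
Qed.

Lemma poly_mono_ind (P : {poly k} -> Prop) :
  P 0 -> (forall p q, P p -> P q -> P (p + q)) ->
  (forall c i, P (c *: 'X^i)) -> forall p, P p.
Proof.
move=> P0 PD PU p; rewrite -[p]coefK poly_def; exact: (big_ind P).
Qed.

Lemma tscaleA p q f : tscale p (tscale q f) = tscale (p * q) f.
Proof.
elim/tpoly_ind: f => [|f g IHf IHg|a j]; first by rewrite !tscale0r.
  by rewrite !tscaleDr IHf IHg.
elim/poly_mono_ind: q => [|q r IHq IHr|d l].
- by rewrite mulr0 !tscale0l tscale0r.
- by rewrite tscaleDl tscaleDr IHq IHr mulrDr tscaleDl.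
elim/poly_mono_ind: p => [|p r IHp IHr|c i]; first by rewrite mul0r !tscale0l.
  by rewrite !tscaleDl IHp IHr mulrDl tscaleDl.
rewrite !tscaleUU -scalerAl -scalerAr !scalerA -exprD tscaleUU.
by rewrite addnA.
Qed.

Lemma tscale1 f : tscale 1 f = f.
Proof.
elim/tpoly_ind: f => [|f g IHf IHg|a j]; first by rewrite tscale0r.
  by rewrite tscaleDr IHf IHg.
by have := tscaleUU 1 0 a j; rewrite expr0 !scale1r.
Qed.

End Polynomials.

HB.instance Definition _ (k : fieldType) (A : lmodType k) :=
  GRing.Zmodule_isLmodule.Build {poly k} (tpoly A)
    (@tscaleA k A) (@tscale1 k A) (@tscaleDr k A) (@tscaleDl k A).

(* The k[t]-(multi)linear extensions to A[t] of (multi)linear maps on A: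
   N(a t^i) = N(a) t^i, mu(a t^i, b t^j) = mu(a, b) t^(i + j), etc. They are
   only meaningful for (multi)linear maps. *)
Section Extensions.
Variables (k : fieldType) (A : lmodType k).
Local Notation At := (tpoly A).

Definition ext1 (N : A -> A) (f : At) : At :=
  \sum_(i <- msupp f) tmono (N f@_i) i.

Definition ext2 (mu : A -> A -> A) (f g : At) : At :=
  \sum_(i <- msupp f) \sum_(j <- msupp g) tmono (mu f@_i g@_j) (i + j).

Definition ext3 (nu : A -> A -> A -> A) (f g h : At) : At :=
  \sum_(i <- msupp f) \sum_(j <- msupp g) \sum_(l <- msupp h)
    tmono (nu f@_i g@_j h@_l) (i + j + l).

End Extensions.

Section Deformations.
Variables (k : fieldType) (A : lmodType k).
Variables (mul : A -> A -> A) (br : A -> A -> A -> A).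
Local Notation At := (tpoly A).

Record deformation_terms := DeformationTerms {
  phi1 : A -> A -> A;
  psi1 : A -> A -> A -> A;
  psi2 : A -> A -> A -> A
}.
Implicit Type D : deformation_terms.

(* a ._t b = a . b + t phi1(a, b); the scalar t of k[t] is 'X : {poly k} *)
Definition mul_t D (f g : At) : At :=
  ext2 mul f g + ('X : {poly k}) *: ext2 (phi1 D) f g.

Definition br_t D (f g h : At) : At :=
  ext3 br f g h + ('X : {poly k}) *: ext3 (psi1 D) f g h
                + ('X^2 : {poly k}) *: ext3 (psi2 D) f g h.

Definition linear_deformation12 D : Prop :=
  [/\ sym_bilinear (phi1 D), skew_trilinear (psi1 D), skew_trilinear (psi2 D)
    & nambu_poisson (mul_t D) (br_t D)].

Definition id_plus_t (N : A -> A) (f : At) : At :=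
  f + ('X : {poly k}) *: ext1 N f.

Definition defines_equivalence D D' (N : A -> A) : Prop :=
  linear N /\
  nambu_poisson_hom (mul_t D) (br_t D) (mul_t D') (br_t D') (id_plus_t N).

Definition equivalent_deformations D D' : Prop :=
  exists N : A -> A, defines_equivalence D D' N.

Definition undeformed : deformation_terms :=
  DeformationTerms (fun _ _ => 0) (fun _ _ _ => 0) (fun _ _ _ => 0).

Definition trivial_deformation D : Prop :=
  equivalent_deformations D undeformed.

End Deformations.

(* Main.v *)
Require Import Defs.
From mathcomp Require Import all_boot all_order all_algebra.
From mathcomp.multinomials Require Import monalg.
Import GRing.Theory.
Local Open Scope ring_scope.

Set Implicit Arguments.
Unset Strict Implicit.

(** Evaluate the two homomorphism identities on constants [a t^0] and compare
coefficients of powers of [t]. The product gives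
[phi1(a, b) + N(ab) = N(a)b + aN(b)] in degree 1 and
[N(phi1(a, b)) = N(a)N(b)] in degree 2; the bracket expresses [psi1] in degree 1 and [psi2] in degree 2
through [N], and gives [N(psi2(a, b, c)) = {N a, N b, N c}] in degree 3.
Eliminating [phi1], [psi1] and [psi2] leaves the Nijenhuis identities. *)

(** * Additivity of the $k[t]$-extensions and their values on monomials *)

Section ExtensionTheory.
Variables (k : fieldType) (A : lmodType k).
Implicit Types (a b c : A) (f g h : tpoly A).

Lemma scaleXn_tmono n a i : ('X^n : {poly k}) *: tmono a i = tmono a (n + i).
Proof. by have := tscaleUU 1 n a i; rewrite !scale1r. Qed.

Lemma scaleX_tmono a i : ('X : {poly k}) *: tmono a i = tmono a i.+1.
Proof. exact: (scaleXn_tmono 1). Qed.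

Section Linear.
Variable N : A -> A.
Hypothesis ND : {morph N : a b / a + b}.

Let F (i : nat) a : tpoly A := tmono (N a) i.

Let FD i : {morph F i : a b / a + b}.
Proof. by move=> a b; rewrite /F ND tmonoD. Qed.

Lemma ext1D : {morph ext1 N : f g / f + g}.
Proof. exact: tsumD FD. Qed.

(** For [a = 0] the monomial has empty support; [tsumU] covers this case because additivity forces
    [F i 0 = 0]. *)
Lemma ext1_tmono a i : ext1 N (tmono a i) = tmono (N a) i.
Proof. exact: (tsumU FD). Qed.

End Linear.

Section Bilinear.
Variable mu : A -> A -> A.
Hypothesis muDl : forall b, {morph mu^~ b : a a' / a + a'}.
Hypothesis muDr : forall a, {morph mu a : b b' / b + b'}.

(** The double sum is read as nested [tsum]s: [ext2 mu f g] is convertible to [tsum (G g) f], so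
    [tsumD] and [tsumU] treat one argument at a time. *)
Let F i a j b : tpoly A := tmono (mu a b) (i + j).
Let G g i a : tpoly A := tsum (F i a) g.

Let FD i a j : {morph F i a j : b b' / b + b'}.
Proof. by move=> b b'; rewrite /F muDr tmonoD. Qed.

Let GD g i : {morph G g i : a a' / a + a'}.
Proof.
move=> a a'; rewrite /G /tsum -big_split; apply: eq_bigr => j _.
by rewrite /F muDl tmonoD.
Qed.

Lemma ext2Dl g : {morph ext2 mu ^~ g : f f' / f + f'}.
Proof. exact: tsumD (GD g). Qed.

Lemma ext2Dr f : {morph ext2 mu f : g g' / g + g'}.
Proof.
(* The outer range [msupp f] is common to all three sums, so only the inner [tsum] over the second
   argument has to be split. *)
move=> g g'; rewrite /ext2 -big_split; apply: eq_bigr => i _.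
exact: (tsumD (FD i f@_i)).
Qed.

Lemma ext2_tmono a i b j :
  ext2 mu (tmono a i) (tmono b j) = tmono (mu a b) (i + j).
Proof.
transitivity (G (tmono b j) i a); first exact: (tsumU (GD _)).
exact: (tsumU (FD i a)).
Qed.

End Bilinear.

Section Trilinear.
Variable nu : A -> A -> A -> A.
Hypothesis nuDl : forall b c, {morph (fun a => nu a b c) : a a' / a + a'}.
Hypothesis nuDm : forall a c, {morph (fun b => nu a b c) : b b' / b + b'}.
Hypothesis nuDr : forall a b, {morph nu a b : c c' / c + c'}.

(** The same nesting with three levels: [H] freezes the first argument, [G] the first two, and
    [ext3 nu f g h] is convertible to [tsum (H g h) f]. *)
Let F i a j b l c : tpoly A := tmono (nu a b c) (i + j + l).
Let G h i a j b : tpoly A := tsum (F i a j b) h.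
Let H g h i a : tpoly A := tsum (G h i a) g.

Let FD i a j b l : {morph F i a j b l : c c' / c + c'}.
Proof. by move=> c c'; rewrite /F nuDr tmonoD. Qed.

Let GD h i a j : {morph G h i a j : b b' / b + b'}.
Proof.
move=> b b'; rewrite /G /tsum -big_split; apply: eq_bigr => l _.
by rewrite /F nuDm tmonoD.
Qed.

Let HD g h i : {morph H g h i : a a' / a + a'}.
Proof.
move=> a a'; rewrite /H /tsum -big_split; apply: eq_bigr => j _.
rewrite /G /tsum -big_split; apply: eq_bigr => l _.
by rewrite /F nuDl tmonoD.
Qed.

Lemma ext3Dl g h : {morph (fun f => ext3 nu f g h) : f f' / f + f'}.
Proof. exact: tsumD (HD g h). Qed.

Lemma ext3Dm f h : {morph (fun g => ext3 nu f g h) : g g' / g + g'}.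
Proof.
move=> g g'; rewrite /ext3 -big_split; apply: eq_bigr => i _.
exact: (tsumD (GD h i f@_i)).
Qed.

Lemma ext3Dr f g : {morph ext3 nu f g : h h' / h + h'}.
Proof.
move=> h h'; rewrite /ext3 -big_split; apply: eq_bigr => i _.
rewrite -big_split; apply: eq_bigr => j _.
exact: (tsumD (FD i f@_i j g@_j)).
Qed.

Lemma ext3_tmono a i b j c l :
  ext3 nu (tmono a i) (tmono b j) (tmono c l) = tmono (nu a b c) (i + j + l).
Proof.
transitivity (H (tmono b j) (tmono c l) i a); first exact: (tsumU (HD _ _)).
transitivity (G (tmono c l) i a j b); first exact: (tsumU (GD _ _ _)).
exact: (tsumU (FD i a j b)).
Qed.

End Trilinear.

Lemma mul_t_undeformed mul : mul_t mul (undeformed A) =2 ext2 mul.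
Proof.
move=> f g; rewrite /mul_t /= [X in _ *: X]big1 ?scaler0 ?addr0 // => i _.
by rewrite big1 // => j _; apply: tmono0.
Qed.

Lemma br_t_undeformed br f g h : br_t br (undeformed A) f g h = ext3 br f g h.
Proof.
have ext30 : ext3 (fun _ _ _ : A => 0) f g h = 0.
  rewrite /ext3 big1 // => i _; rewrite big1 // => j _; rewrite big1 // => l _.
  exact: tmono0.
by rewrite /br_t /= ext30 !scaler0 !addr0.
Qed.

Lemma id_plus_t_tmono (N : A -> A) a i : {morph N : b c / b + c} ->
  id_plus_t N (tmono a i) = tmono a i + tmono (N a) i.+1.
Proof. by move=> ND; rewrite /id_plus_t ext1_tmono // scaleX_tmono. Qed.

Lemma id_plus_tD (N : A -> A) : {morph N : b c / b + c} ->
  {morph id_plus_t N : f g / f + g}.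
Proof. by move=> ND f g; rewrite /id_plus_t ext1D // scalerDr addrACA. Qed.

Lemma mcoeff_tmono a i j : (tmono a i)@_j = a *+ (i == j).
Proof. exact: mcoeffU. Qed.

End ExtensionTheory.

Lemma linearDP (k : fieldType) (A B : lmodType k) (f : A -> B) :
  linear f -> {morph f : a b / a + b}.
Proof. by move=> fL a b; rewrite -[a in LHS]scale1r fL scale1r. Qed.

Lemma sym_bilinearD (k : fieldType) (A : lmodType k) (mu : A -> A -> A) :
  sym_bilinear mu ->
  (forall b, {morph mu^~ b : a a' / a + a'}) *
  (forall a, {morph mu a : b b' / b + b'}).
Proof.
by move=> [[muL muR] _]; split=> c;
  [exact: linearDP (muL c) | exact: linearDP (muR c)].
Qed.

Lemma skew_trilinearD (k : fieldType) (A : lmodType k) (nu : A -> A -> A -> A) :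
  skew_trilinear nu ->
  [/\ forall b c, {morph (fun a => nu a b c) : a a' / a + a'},
      forall a c, {morph (fun b => nu a b c) : b b' / b + b'}
    & forall a b, {morph nu a b : c c' / c + c'}].
Proof.
by move=> [nuL nuM nuR _ _]; split=> a b;
  [exact: linearDP (nuL a b) | exact: linearDP (nuM a b)
  | exact: linearDP (nuR a b)].
Qed.

(** * Coefficient identities of an equivalence with the undeformed algebra *)

Section Equivalence.
Variables (k : fieldType) (A : lmodType k).
Variables (mul : A -> A -> A) (br : A -> A -> A -> A).
Variables (D : deformation_terms A) (N : A -> A).
Hypothesis npA : nambu_poisson mul br.
Hypothesis defD : linear_deformation12 mul br D.
Hypothesis eqvN : defines_equivalence mul br D (undeformed A) N.

Let ND : {morph N : a b / a + b}.
Proof. by case: eqvN => NL _; exact: linearDP. Qed.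

Lemma equivalence_mul_coef a b :
  phi1 D a b + N (mul a b) = mul (N a) b + mul a (N b) /\
  N (phi1 D a b) = mul (N a) (N b).
Proof.
have [/sym_bilinearD[mulDl mulDr] _ _ _ _] := npA.
have [/sym_bilinearD[phiDl phiDr] _ _ _] := defD.
have [_ [_ /(_ (tmono a 0) (tmono b 0)) + _]] := eqvN.
rewrite mul_t_undeformed /mul_t !ext2_tmono // scaleX_tmono.
(* Both sides become sums of four monomials of degree at most 2. *)
rewrite id_plus_tD // !id_plus_t_tmono // ext2Dl // !ext2Dr // !ext2_tmono //.
move=> E; split.
- have := congr1 (mcoeff 1%N) E; rewrite !mcoeffD !mcoeff_tmono /=.
  by rewrite !mulr0n !mulr1n !add0r !addr0 addrC => ->; rewrite addrC.
- have := congr1 (mcoeff 2%N) E; rewrite !mcoeffD !mcoeff_tmono /=.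
  by rewrite !mulr0n !mulr1n !add0r.
Qed.

Lemma equivalence_br_coef a b c :
  [/\ psi1 D a b c + N (br a b c) =
        br (N a) b c + br a (N b) c + br a b (N c),
      psi2 D a b c + N (psi1 D a b c) =
        br (N a) (N b) c + br (N a) b (N c) + br a (N b) (N c)
    & N (psi2 D a b c) = br (N a) (N b) (N c)].
Proof.
have [_ _ /skew_trilinearD[brDl brDm brDr] _ _] := npA.
have [_ /skew_trilinearD[psi1Dl psi1Dm psi1Dr]
        /skew_trilinearD[psi2Dl psi2Dm psi2Dr] _] := defD.
have [_ [_ _ /(_ (tmono a 0) (tmono b 0) (tmono c 0))]] := eqvN.
rewrite br_t_undeformed /br_t !ext3_tmono // scaleX_tmono scaleXn_tmono.
(* The right side expands into eight monomials, each with exponent the number of arguments to which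
   [N] is applied; the left side has six, from [br], [psi1], [psi2] and their images under [N]. *)
rewrite !id_plus_tD // !id_plus_t_tmono // ext3Dl // !ext3Dm // !ext3Dr //.
rewrite !ext3_tmono // => E; split.
- have := congr1 (mcoeff 1%N) E; rewrite !mcoeffD !mcoeff_tmono /=.
  rewrite !mulr0n !mulr1n !add0r !addr0 addrC => ->.
  by rewrite addrC [X in _ + X]addrC addrA.
- have := congr1 (mcoeff 2%N) E; rewrite !mcoeffD !mcoeff_tmono /=.
  rewrite !mulr0n !mulr1n !add0r !addr0 addrC => ->.
  by rewrite addrC [X in X + _]addrC.
- have := congr1 (mcoeff 3%N) E; rewrite !mcoeffD !mcoeff_tmono /=.
  by rewrite !mulr0n !mulr1n !add0r.
Qed.

End Equivalence.

Unset Implicit Arguments.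

Theorem mainTheorem1 (k : fieldType) (char0 : [pchar k] =i pred0)
    (A : lmodType k) (mul : A -> A -> A) (br : A -> A -> A -> A)
    (D : deformation_terms A) (N : A -> A) :
  nambu_poisson mul br ->
  linear_deformation12 mul br D ->
  trivial_deformation mul br D ->
  linear N ->
  defines_equivalence mul br D (undeformed A) N ->
  nijenhuis mul br N.
Proof.
move=> npA defD _ NL eqvN; split=> // [a b | a b c].
  (* Reading the identities from right to left turns both sides into [N (phi1 D a b)], once
     [N (mul a b)] cancels. *)
  by have [<- <-] := equivalence_mul_coef npA defD eqvN a b; rewrite addrK.
have [<- <- <-] := equivalence_br_coef npA defD eqvN a b c.
(* Two nested cancellations: the inner bracket reduces to [psi1 D a b c], then the outer one to
   [psi2 D a b c]. *)
by rewrite !addrK.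
Qed.
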